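(* Let $m \ge 3$ be odd and $n = 3^m-1$. Then the dual code $\mathcal{C}_{(0,1,m)}^\perp$ has parameters $[n,k,d]$ with $d \ge \frac{3^{(m-1)/2}+9}{2}$ if $m \equiv 3 \pmod 4$ and $d \ge \frac{3^{(m-1)/2}+7}{2}$ if $m \equiv 1 \pmod 4$, and $k = \frac{n-2}{2}$ if $m \equiv 3 \pmod 4$ and $k = \frac{n}{2}$ if $m \equiv 1 \pmod 4$.
   Context: Let $m \ge 2$ be an integer, $n = 3^m-1$, and let $\alpha$ be a primitive element of $\mathbb{F}_{3^m}$. For an integer $0 \le j \le n-1$ with $3$-adic expansion $j = \sum_{t=0}^{m-1} j_t 3^t$, $j_t \in \{0,1,2\}$, let $w_3(j) = \sum_{t=0}^{m-1} j_t$. For distinct $i_1, i_2 \in \{0,1,2,3\}$ let $T_{(i_1,i_2,m)} = \{1 \le j \le n-1 : w_3(j) \equiv i_1 \text{ or } i_2 \pmod 4\}$ and $g_{(i_1,i_2,m)}(x) = \prod_{j \in T_{(i_1,i_2,m)}} (x - \alpha^j) \in \mathbb{F}_3[x]$. $\mathcal{C}_{(i_1,i_2,m)}$ denotes the ternary cyclic code of length $n$ with generator polynomial $g_{(i_1,i_2,m)}(x)$, and $\mathcal{C}^\perp$ denotes the dual code with respect to the standard inner product on $\mathbb{F}_3^n$. Parameters $[n,k,d]$ mean length, dimension over $\mathbb{F}_3$, and minimum Hamming distance. *)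

(* Defs.v *)
From HB Require Import structures.
From mathcomp Require Import all_boot all_order all_algebra all_field.

Set Implicit Arguments.
Unset Strict Implicit.
Unset Printing Implicit Defensive.

Import GRing.Theory.
Local Open Scope ring_scope.

Definition w3 (m j : nat) : nat := (\sum_(t < m) ((j %/ 3 ^ t) %% 3))%N.

Definition Tset (i1 i2 m : nat) : seq nat :=
  [seq j <- iota 1 (3 ^ m - 2) |
    ((w3 m j %% 4 == i1) || (w3 m j %% 4 == i2))%N].

(* g_(i1,i2,m)(x) = prod_{j in T} (x - alpha^j), computed in F[x] where F = F_{3^m}. *)
Definition gen_poly (F : fieldType) (alpha : F) (i1 i2 m : nat) : {poly F} :=
  \prod_(j <- Tset i1 i2 m) ('X - (alpha ^+ j)%:P).

(* The prime field F_3 embedded in F (F has characteristic 3). *)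
Definition F3_to (F : fieldType) (x : 'F_3) : F := (val x)%:R.

Definition word_poly (F : fieldType) (n : nat) (c : 'rV['F_3]_n) : {poly F} :=
  \sum_(i < n) (F3_to F (c 0 i))%:P * 'X^i.

Definition cyclic_code (F : fieldType) (alpha : F) (i1 i2 m : nat)
  : {set 'rV['F_3]_(3 ^ m - 1)} :=
  [set c | gen_poly alpha i1 i2 m %| word_poly F c].

Definition dotF3 (n : nat) (u v : 'rV['F_3]_n) : 'F_3 := \sum_(i < n) u 0 i * v 0 i.

Definition dual_code (n : nat) (C : {set 'rV['F_3]_n}) : {set 'rV['F_3]_n} :=
  [set v | [forall c in C, dotF3 v c == 0]].

Definition code_space (n : nat) (C : {set 'rV['F_3]_n}) : {vspace 'rV['F_3]_n} :=
  <<enum C>>%VS.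

Definition wt (n : nat) (v : 'rV['F_3]_n) : nat := #|[set i | v 0 i != 0]|.

(* Main.v *)
Require Import Defs.
From HB Require Import structures.
From mathcomp Require Import all_boot all_order all_algebra all_field.
From mathcomp Require Import zify.

(** A word is in the dual code iff it vanishes at [alpha ^- j] for [j] outside [T],
    i.e. (for odd [m]) at [alpha ^+ i] for all [i] with ternary digit sum congruent
    to 0 or 3 modulo 4; its dimension is [#|T|].  Put [m = 2h + 1].  Digit sums of
    [a (3^h - 1) + d 3^(2h)] do not depend on [1 <= a <= 3^h], which yields [3^h]
    zeros in an arithmetic progression of even exponents, and the exponents
    [3^(2h) + (3^h + 1) b], [b] odd, yield [(3^h - 1)/2] zeros in a progression of
    odd exponents.  Both steps have gcd 2 with [n], so the BCH argument only sees
    the squares of the locators: a word of weight at most [3^h] must be supported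
    on pairs of opposite locators with opposite coefficients, and the odd
    progression rules these out.  So [d >= 3^h + 1], which suffices unless
    [m = 3]. *)

Set Implicit Arguments.
Unset Strict Implicit.
Unset Printing Implicit Defensive.

Import GRing.Theory.
Local Open Scope ring_scope.

(** * Ternary digit sums *)

Lemma w3_rec (m j : nat) : w3 m.+1 j = (j %% 3 + w3 m (j %/ 3))%N.
Proof.
rewrite /w3 big_ord_recl expn0 divn1; congr (_ + _)%N.
by apply: eq_bigr => t _; rewrite expnS divnMA.
Qed.

Lemma w3_cat (a b x y : nat) :
  (x < 3 ^ a)%N -> w3 (a + b) (x + 3 ^ a * y) = (w3 a x + w3 b y)%N.
Proof.
elim: a x => [|a IHa] x.
  by rewrite expn0 ltnS leqn0 => /eqP->; rewrite mul1n /w3 !big_ord0.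
rewrite expnS => ltx; rewrite addSn !w3_rec -addnA -IHa; last by lia.
by rewrite -mulnA; congr (_ + w3 _ _)%N; lia.
Qed.

(** Subtracting from [3 ^ m - 1] replaces each digit [d] by [2 - d], without carries. *)
Lemma w3_compl (m j : nat) :
  (j < 3 ^ m)%N -> (w3 m (3 ^ m - 1 - j) + w3 m j = 2 * m)%N.
Proof.
elim: m j => [|m IHm] j; first by rewrite /w3 !big_ord0.
rewrite expnS => ltj; rewrite !w3_rec.
have /IHm : (j %/ 3 < 3 ^ m)%N by lia.
have -> : ((3 * 3 ^ m - 1 - j) %/ 3 = 3 ^ m - 1 - j %/ 3)%N by lia.
by lia.
Qed.

(** Every power of 3 is odd. *)
Lemma odd_w3 (m j : nat) : (j < 3 ^ m)%N -> odd (w3 m j) = odd j.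
Proof.
elim: m j => [|m IHm] j.
  by rewrite expn0 ltnS leqn0 => /eqP->; rewrite /w3 big_ord0.
rewrite expnS => ltj; rewrite w3_rec oddD IHm; last by lia.
by rewrite [in RHS](divn_eq j 3); lia.
Qed.

Lemma w3_1 (d : nat) : (d < 3)%N -> w3 1 d = d.
Proof. by move=> ltd; rewrite /w3 big_ord1 expn0 divn1 modn_small. Qed.

Lemma w3_0 (m : nat) : w3 m 0 = 0%N.
Proof. by rewrite /w3 big1 // => t _; rewrite div0n. Qed.

(* Multiplication by 3 modulo [3 ^ m - 1] rotates the ternary digits. *)
Lemma w3_mul3_mod (m j : nat) :
  (j < 3 ^ m - 1)%N -> w3 m ((3 * j) %% (3 ^ m - 1)) = w3 m j.
Proof.
case: m => // m ltj.
pose q := (j %/ 3 ^ m)%N; pose r := (j %% 3 ^ m)%N.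
have p0 : (0 < 3 ^ m)%N by rewrite expn_gt0.
have ltr : (r < 3 ^ m)%N by rewrite ltn_mod.
have jE : j = (r + 3 ^ m * q)%N by rewrite addnC mulnC -divn_eq.
clearbody q r; subst j; move: ltj; rewrite expnS => ltj.
have ltq : (q < 3)%N by nia.
have -> : ((3 * (r + 3 ^ m * q)) %% (3 * 3 ^ m - 1) = 3 * r + q)%N.
  have -> : (3 * (r + 3 ^ m * q) = q * (3 * 3 ^ m - 1) + (3 * r + q))%N by nia.
  by rewrite modnMDl modn_small //; nia.
rewrite -addn1 w3_cat // w3_1 // addn1 w3_rec addnC.
by congr (w3 _ _ + _)%N; lia.
Qed.

(** * The exponent set [T] and its size *)

Lemma Tset_uniq (i1 i2 m : nat) : uniq (Tset i1 i2 m).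
Proof. by rewrite filter_uniq ?iota_uniq. Qed.

Lemma mem_Tset (i1 i2 m j : nat) : (j \in Tset i1 i2 m) =
  [&& (w3 m j %% 4 == i1) || (w3 m j %% 4 == i2), 0 < j & j < 3 ^ m - 1]%N.
Proof.
rewrite mem_filter mem_iota; congr (_ && _).
by case: j => // j; apply/idP/idP; lia.
Qed.

(** The shift [r] makes the count recursive: a split-off digit is absorbed into it. *)
Definition low_w3 (m r : nat) : nat :=
  \sum_(j < 3 ^ m) ((w3 m j + r) %% 4 < 2)%N.

Lemma low_w3_compl (m r : nat) : (low_w3 m r + low_w3 m r.+2 = 3 ^ m)%N.
Proof.
rewrite /low_w3 -big_split /= -[RHS]card_ord -sum1_card.
by apply: eq_bigr => j _; lia.
Qed.

(** The last digit shifts [r] by 0, 1 or 2; the shifts by 0 and 2 together count everything, which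
    leaves the shift by 1. *)
Lemma low_w3_rec (m r : nat) : (low_w3 m.+1 r = 3 ^ m + low_w3 m r.+1)%N.
Proof.
rewrite -(low_w3_compl m r) addnAC /low_w3 expnSr.
pose G j : nat := ((w3 m.+1 j + r) %% 4 < 2)%N.
rewrite -(big_mkord predT G) /= big_nat_mul.
have -> : (\sum_(0 <= i < 3 ^ m) \sum_(i * 3 <= j < i.+1 * 3) G j =
  \sum_(j < 3 ^ m) (G (3 * j) + G (3 * j).+1 + G (3 * j).+2))%N.
  rewrite big_mkord; apply: eq_bigr => j _.
  rewrite mulSn mulnC -{1}[(3 * j)%N]add0n big_addn addnK.
  by rewrite 3?big_nat_recr //= big_geq.
rewrite !big_split /=; congr (_ + _ + _)%N; apply: eq_bigr => j _;
  rewrite /G w3_rec; congr (nat_of_bool (_ < _))%N.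
- by rewrite mulKn // modnMr.
- by rewrite -addn1 mulnC divnMDl // modnMDl addn0 /=; congr (_ %% _)%N; lia.
- by rewrite -addn2 mulnC divnMDl // modnMDl addn0 /=; congr (_ %% _)%N; lia.
Qed.

(** Two steps of the recursion lead from shift 0 to shift 2, the complement of shift 0, so the
    correction to [3 ^ (2 * k).+1] alternates in sign with [k]. *)
Lemma low_w3_odd (k : nat) : (2 * low_w3 (2 * k).+1 0 + odd k =
  3 ^ (2 * k).+1 + ~~ odd k)%N.
Proof.
elim: k => [|k IHk].
  by rewrite muln0 low_w3_rec /low_w3 big_ord1 /w3 big_ord0.
have -> : (2 * k.+1).+1 = (2 * k).+3 by lia.
rewrite 2!low_w3_rec; have := low_w3_compl (2 * k).+1 0.
by rewrite !expnS in IHk *; rewrite oddS; lia.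
Qed.

Lemma size_Tset01 (m : nat) : (0 < m)%N -> odd m ->
  (2 * size (Tset 0 1 m) + 1 + (m %% 4 == 3) = 3 ^ m - (m %% 4 == 3))%N.
Proof.
move=> m_gt0 m_odd; have := low_w3_odd m./2.
have -> : (2 * m./2).+1 = m by lia.
have -> : odd m./2 = (m %% 4 == 3)%N by lia.
(* [T] omits both ends of the range: 0 is counted by [low_w3], while [3 ^ m - 1] has digit sum
   [2 * m], which is 2 modulo 4, and is not. *)
suff -> : low_w3 m 0 = (size (Tset 0 1 m)).+1 by case: eqP => _ /=; lia.
rewrite /low_w3 -(big_mkord predT (fun j => nat_of_bool ((w3 m j + 0) %% 4 < 2)%N)).
have -> : (3 ^ m = (3 ^ m - 2).+2)%N.
  by case: m m_gt0 {m_odd} => // m _; have := expn_gt0 3 m; rewrite expnS; lia.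
rewrite big_nat_recr // big_nat_recl //= w3_0.
have -> : w3 m (3 ^ m - 2).+1 = (2 * m)%N.
  have := @w3_compl m 0; rewrite subn0 w3_0 addn0 expn_gt0 => <- //.
  by congr w3; case: m m_gt0 {m_odd} => // m _; have := expn_gt0 3 m; rewrite expnS; lia.
rewrite !addn0 (_ : ((2 * m) %% 4 < 2)%N = false) ?addn0; last by lia.
rewrite size_filter -sum1_count (iotaDl 1 0) big_map -big_mkcond /= /index_iota subn0.
congr (_.+1); rewrite big_mkcond [RHS]big_mkcond; apply: eq_bigr => j _ /=.
by rewrite addn0 add1n; case: (w3 _ _ %% 4)%N => [|[|]].
Qed.

(** * The prime field inside [F], dimensions as ranks, and sums over roots of unity *)

Lemma F3_to_rmorphism (F : fieldType) : 3%N \in [pchar F] ->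
  exists f : {rmorphism 'F_3 -> F}, forall x, f x = F3_to F x.
Proof.
move=> char3.
have fN (x : nat) : F3_to F x%:R = x%:R.
  rewrite /F3_to -[val _]/(nat_of_ord _) val_Fp_nat //.
  exact: GRing.natr_mod_pchar.
have valE (x : 'F_3) : x = (val x)%:R by rewrite [RHS]natr_Zp.
have fD x y : F3_to F (x + y) = F3_to F x + F3_to F y.
  by rewrite [x]valE [y]valE -natrD !fN natrD.
have fB : zmod_morphism (F3_to F).
  by move=> x y; apply: (canRL (addrK _)); rewrite -fD subrK.
have fM : monoid_morphism (F3_to F).
  split; first exact: (fN 1%N).
  by move=> x y; rewrite [x]valE [y]valE -natrM !fN natrM.
pose fBM := GRing.isZmodMorphism.Build _ _ _ fB.
pose fMM := GRing.isMonoidMorphism.Build _ _ _ fM.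
pose f : {rmorphism 'F_3 -> F} := HB.pack (F3_to F) fBM fMM.
by exists f.
Qed.

Lemma cube_fixed_in_F3 (F : fieldType) (f : {rmorphism 'F_3 -> F}) (x : F) :
  x ^+ 3 = x -> exists y, f y = x.
Proof.
move=> /eqP; rewrite -subr_eq0 exprS -{3}[x]mulr1 -mulrBr mulf_eq0.
rewrite subr_eq0 -(expr1n F 2) eqf_sqr => /or3P[] /eqP->.
- by exists 0; rewrite rmorph0.
- by exists 1; rewrite rmorph1.
- by exists (- 1); rewrite rmorphN rmorph1.
Qed.

Lemma dim_code_space_submx (n r : nat) (C : {set 'rV['F_3]_n}) (M : 'M_(r, n)) :
  (forall v, (v \in C) = (v <= M)%MS) -> \dim (code_space C) = \rank M.
Proof.
move=> memC.
(* A row basis makes the map [f] injective, so its image has the dimension of its source. *)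
have memR v : (v \in C) = (v <= row_base M)%MS by rewrite memC eq_row_base.
pose f := linfun (mulmxr (row_base M)) : 'Hom('rV_(\rank M), 'rV_n).
have -> : code_space C = limg f.
  apply/eqP; rewrite eqEsubv; apply/andP; split.
    apply/span_subvP => v; rewrite mem_enum memR => /submxP[u ->].
    by apply/memv_imgP; exists u; rewrite ?memvf // lfunE.
  apply/subvP => _ /memv_imgP[u _ ->]; apply: memv_span.
  by rewrite mem_enum memR lfunE submxMl.
rewrite limg_dim_eq; first by rewrite dimvf dim_matrix mul1r.
apply/eqP; rewrite capfv; apply/lker0P => u v; rewrite !lfunE /=.
exact/row_free_inj/row_base_free.
Qed.

Lemma prim_root_neq0 (F : fieldType) (n : nat) (alpha : F) :
  n.-primitive_root alpha -> alpha != 0.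
Proof.
move=> pra; apply: contra_eq_neq (prim_expr_order pra) => ->.
by rewrite expr0n gtn_eqF ?(prim_order_gt0 pra) // eq_sym oner_eq0.
Qed.

(** Orthogonality of characters: off the diagonal, the geometric sum is killed by a nonzero
    factor. *)
Lemma sum_prim_root_expr (F : fieldType) (n : nat) (alpha : F) (i j : nat) :
  n.-primitive_root alpha -> (i < n)%N -> (j < n)%N ->
  \sum_(k < n) (alpha ^+ i / alpha ^+ j) ^+ k = n%:R *+ (i == j).
Proof.
move=> pra lti ltj; have n_gt0 := prim_order_gt0 pra.
have ua l : alpha ^+ l != 0 by rewrite expf_neq0 // (prim_root_neq0 pra).
case: eqVneq => [->|neq].
  rewrite divff //; under eq_bigr do rewrite expr1n.
  by rewrite sumr_const card_ord.
set x := _ / _; have /eqP : (x - 1) * \sum_(k < n) x ^+ k = 0.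
  rewrite -subrX1 expr_div_n -!exprM ![(_ * n)%N]mulnC !exprM.
  by rewrite (prim_expr_order pra) !expr1n divr1 subrr.
rewrite mulf_eq0 => /predU1P[/eqP|/eqP//]; rewrite subr_eq0 => /eqP x1.
have /eqP : alpha ^+ i = alpha ^+ j by rewrite -[LHS](divfK (ua j)) -/x x1 mul1r.
by rewrite (eq_prim_root_expr pra) !modn_small // (negPf neq).
Qed.

(** * Zeros and dimension of the dual code *)

(** Tripling an exponent is the Frobenius map on powers of [alpha], hence injective, and it rotates
    the digits. *)
Lemma perm_Tset_mul3 (F : fieldType) (alpha : F) (i1 i2 m : nat) :
  3%N \in [pchar F] -> (3 ^ m - 1).-primitive_root alpha ->
  perm_eq [seq (3 * j) %% (3 ^ m - 1) | j <- Tset i1 i2 m]%N (Tset i1 i2 m).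
Proof.
move=> char3 pra; set T := Tset i1 i2 m.
have inj3 : {in T &, injective (fun j => (3 * j) %% (3 ^ m - 1))%N}.
  move=> i j; rewrite !mem_Tset => /and3P[_ _ lti] /and3P[_ _ ltj] /eqP.
  rewrite -(eq_prim_root_expr pra) mulnC exprM [(3 * j)%N]mulnC exprM.
  rewrite -!(pFrobenius_autE char3) (inj_eq (fmorph_inj _)).
  by rewrite (eq_prim_root_expr pra) !modn_small // => /eqP.
have u3 : uniq [seq (3 * j) %% (3 ^ m - 1) | j <- T]%N.
  by rewrite map_inj_in_uniq ?Tset_uniq.
apply: uniq_perm => //; first exact: Tset_uniq.
apply: (uniq_min_size u3 _ _).2; last by rewrite size_map.
move=> _ /mapP[j Tj ->]; move: (Tj); rewrite !mem_Tset => /and3P[wj j0 ltj].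
rewrite w3_mul3_mod // wj ltn_mod (prim_order_gt0 pra) andbT /= lt0n.
apply/eqP => j3; have : alpha ^+ (j * 3) == alpha ^+ (0 * 3).
  by rewrite (eq_prim_root_expr pra) mulnC j3 mod0n.
rewrite !exprM.
rewrite -!(pFrobenius_autE char3) (inj_eq (fmorph_inj _)).
by rewrite (eq_prim_root_expr pra) !modn_small ?(prim_order_gt0 pra) // gtn_eqF.
Qed.

Lemma horner_word_poly (F : fieldType) (n : nat) (c : 'rV['F_3]_n) (x : F) :
  (word_poly F c).[x] = \sum_(k < n) F3_to F (c 0 k) * x ^+ k.
Proof.
rewrite horner_sum; apply: eq_bigr => k _.
by rewrite hornerM hornerC hornerXn.
Qed.

Lemma mem_cyclic_code (F : fieldType) (alpha : F) (i1 i2 m : nat)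
    (c : 'rV['F_3]_(3 ^ m - 1)) : (3 ^ m - 1).-primitive_root alpha ->
  reflect {in Tset i1 i2 m, forall j, (word_poly F c).[alpha ^+ j] = 0}
    (c \in cyclic_code alpha i1 i2 m).
Proof.
move=> pra; rewrite inE /gen_poly.
rewrite -(big_map (fun j => alpha ^+ j) predT (fun z => 'X - z%:P)) /=.
apply: (iffP idP) => [gc j Tj|c0].
  apply/eqP; rewrite -/(root _ _) -dvdp_XsubCl; apply: dvdp_trans gc.
  by rewrite (big_rem (alpha ^+ j)) ?dvdp_mulIl //; apply: map_f.
apply: uniq_roots_dvdp; first by apply/allP => _ /mapP[j Tj ->]; apply/eqP/c0.
rewrite uniq_rootsE map_inj_in_uniq ?Tset_uniq // => i j.
rewrite !mem_Tset => /and3P[_ _ lti] /and3P[_ _ ltj] /eqP.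
by rewrite (eq_prim_root_expr pra) !modn_small // => /eqP.
Qed.

(* [Q = X *m Y] is the projector whose kernel is the code extended to [F].  The set
   [T] is stable under multiplication by 3, so [Q] is fixed by the Frobenius map
   and descends to ['F_3]; its transpose then projects onto the dual code. *)
Lemma dual_cyclic_code_dim_zeros (F : fieldType) (alpha : F) (i1 i2 m : nat)
    (T := Tset i1 i2 m) (Cd := dual_code (cyclic_code alpha i1 i2 m)) :
  3%N \in [pchar F] -> (0 < m)%N -> (3 ^ m - 1).-primitive_root alpha ->
  \dim (code_space Cd) = size T /\
  (forall c j, c \in Cd -> (j < 3 ^ m - 1)%N -> j \notin T ->
     (word_poly F c).[(alpha ^+ j)^-1] = 0).
Proof.
move=> char3 m_gt0 pra; have [f fE] := F3_to_rmorphism char3.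
have nF : (3 ^ m - 1)%:R = -1 :> F.
  rewrite natrB ?expn_gt0 // natrX (pcharf0 char3) expr0n.
  by rewrite gtn_eqF // sub0r.
pose t_ (i : 'I_(size T)) := nth 0%N T i.
have Tt i : t_ i \in T by rewrite mem_nth.
have ltT j : j \in T -> (j < 3 ^ m - 1)%N by rewrite mem_Tset => /and3P[].
pose X : 'M[F]_(3 ^ m - 1, size T) := \matrix_(k, i) (alpha ^+ t_ i) ^+ k.
(* The minus sign is the factor [1 / n], as [n = -1] in [F]; orthogonality then makes [Y] a left
   inverse of [X]. *)
pose Y : 'M[F]_(size T, 3 ^ m - 1) := \matrix_(i, l) - (alpha ^+ t_ i)^-1 ^+ l.
have YX : Y *m X = 1%:M.
  apply/matrixP => i j; rewrite !mxE.
  under eq_bigr => k _ do rewrite !mxE mulNr mulrC -exprMn.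
  rewrite sumrN sum_prim_root_expr ?ltT // nF /t_ nth_uniq ?Tset_uniq //.
  by rewrite eq_sym -mulNrn opprK.
pose Q := X *m Y.
have QQ : Q *m Q = Q by rewrite /Q mulmxA -[X *m Y *m X]mulmxA YX mulmx1.
have Q3 k l : Q k l ^+ 3 = Q k l.
  pose x := alpha ^+ k / alpha ^+ l.
  have xn : x ^+ (3 ^ m - 1) = 1.
    rewrite expr_div_n -!exprM ![(_ * (3 ^ m - 1))%N]mulnC !exprM.
    by rewrite (prim_expr_order pra) !expr1n divr1.
  (* An entry is a power sum over [T], whose terms are only permuted by cubing. *)
  have -> : Q k l = - \sum_(j <- T) x ^+ j.
    rewrite mxE (big_nth 0%N) big_mkord -sumrN; apply: eq_bigr => i _.
    rewrite !mxE mulrN expr_div_n -!exprM exprVn -exprM.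
    by rewrite ![(t_ i * _)%N]mulnC.
  rewrite -(pFrobenius_autE char3) rmorphN rmorph_sum /=; congr (- _).
  under eq_bigr => j _ do rewrite pFrobenius_autE -exprM mulnC -(expr_mod _ xn).
  by rewrite -[RHS](perm_big _ (perm_Tset_mul3 i1 i2 char3 pra)) big_map.
(* The default 0 is never taken: each entry of [Q] is fixed by cubing and so comes from ['F_3]. *)
pose Q0 : 'M['F_3]_(3 ^ m - 1) :=
  \matrix_(k, l) odflt 0 [pick y | f y == Q k l].
have fQ0 : map_mx f Q0 = Q.
  apply/matrixP => k l; rewrite [LHS]mxE [Q0 k l]mxE; case: pickP => [y /eqP //|noy].
  have [y fy] := cube_fixed_in_F3 f (Q3 k l).
  by have := noy y; rewrite fy eqxx.
have Q00 : Q0 *m Q0 = Q0.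
  by apply: (@map_mx_inj _ _ f); rewrite map_mxM fQ0.
have wordE (c : 'rV_(3 ^ m - 1)) (x : F) :
    (word_poly F c).[x] = (map_mx f c *m \col_k x ^+ k) 0 0.
  rewrite horner_word_poly mxE; apply: eq_bigr => k _.
  by rewrite !mxE fE.
have memC (c : 'rV_(3 ^ m - 1)) : (c \in cyclic_code alpha i1 i2 m) = (c *m Q0 == 0).
  rewrite -(map_mx_eq0 f) map_mxM fQ0.
  have colX i : \col_k (alpha ^+ t_ i) ^+ k = col i X.
    by apply/matrixP => k l; rewrite !mxE.
  apply/(mem_cyclic_code _ _ _ pra)/eqP => [c0|cQ j Tj].
    suff cX : map_mx f c *m X = 0 by rewrite mulmxA cX mul0mx.
    apply/matrixP => i j; rewrite ord1 [RHS]mxE -(c0 _ (Tt j)) wordE colX.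
    by rewrite colE mulmxA -colE [RHS]mxE.
  have ltj : (index j T < size T)%N by rewrite index_mem.
  have -> : j = t_ (Ordinal ltj) by rewrite /t_ nth_index.
  rewrite wordE colX colE mulmxA -[X]mul1mx.
  have -> : map_mx f c *m (1%:M *m X) = map_mx f c *m Q *m X.
    by rewrite mul1mx -!mulmxA YX mulmx1.
  by rewrite cQ !mul0mx mxE.
have dotE n (u v : 'rV['F_3]_n) : dotF3 u v = (u *m v^T) 0 0.
  by rewrite mxE; apply: eq_bigr => k _; rewrite mxE.
have memCd (v : 'rV_(3 ^ m - 1)) : (v \in Cd) = (v *m Q0^T == v).
  rewrite inE; apply/forall_inP/eqP => [v0|vQ c].
    apply/eqP; rewrite eq_sym -subr_eq0; apply/eqP/matrixP => i k; rewrite ord1.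
    (* Idempotence puts the rows of [1%:M - Q0] in the code; orthogonality to all of them says that
       [Q0^T] fixes [v]. *)
    have /v0/eqP vk : row k (1%:M - Q0) \in cyclic_code alpha i1 i2 m.
      by rewrite memC -row_mul mulmxBl mul1mx Q00 subrr row0.
    rewrite [RHS]mxE -[RHS]vk dotE tr_row colE mulmxA -colE.
    by rewrite linearB /= trmx1 mulmxBr mulmx1 [RHS]mxE.
  rewrite memC dotE -vQ -mulmxA -trmx_mul => /eqP->.
  by rewrite trmx0 mulmx0 mxE.
split=> [|c j Cdc ltj nTj].
  rewrite (@dim_code_space_submx _ _ _ Q0^T) => [|v]; last first.
    rewrite memCd; apply/eqP/submxP => [<-|[u ->]]; first by exists v.
    by rewrite -mulmxA -trmx_mul Q00.
  rewrite mxrank_tr -(mxrank_map f) fQ0; apply/eqP.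
  rewrite eqn_leq mulmx_max_rank /= -[X in (X <= _)%N](mxrank1 F).
  (* The identity of size [size T] factors through [Q], which bounds the rank from below. *)
  have <- : Y *m Q *m X = 1%:M by rewrite mulmxA YX mul1mx YX.
  by apply: leq_trans (mxrankM_maxl _ _) (mxrankM_maxr _ _).
have cQ : map_mx f c = map_mx f c *m Q^T.
  by move: Cdc; rewrite memCd => /eqP {1}<-; rewrite map_mxM -map_trmx fQ0.
have XC : X^T *m \col_k (alpha ^+ j)^-1 ^+ k = 0.
  apply/matrixP => i l; rewrite !mxE.
  under eq_bigr => k _ do rewrite !mxE -exprMn.
  rewrite (sum_prim_root_expr pra (ltT _ (Tt i)) ltj).
  by case: eqP nTj => // <-; rewrite Tt.
by rewrite wordE cQ trmx_mul -!mulmxA XC !mulmx0 mxE.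
Qed.

(** Negating an exponent turns digit sum [w] into [2 * m - w], which is [2 - w] modulo 4 for odd
    [m]; residues 0 and 3 become 2 and 3, outside [T]. *)
Lemma dual_code01_zeros (F : fieldType) (alpha : F) (m : nat)
    (c : 'rV['F_3]_(3 ^ m - 1)) (i : nat) :
  3%N \in [pchar F] -> odd m -> (3 ^ m - 1).-primitive_root alpha ->
  c \in dual_code (cyclic_code alpha 0 1 m) ->
  (i < 3 ^ m - 1)%N -> ((w3 m i).+1 %% 4 < 2)%N ->
  (word_poly F c).[alpha ^+ i] = 0.
Proof.
move=> char3 m_odd pra Cdc lti wi.
have [_ zc] := dual_cyclic_code_dim_zeros 0 1 char3 (odd_gt0 m_odd) pra.
have [->|i_gt0] := posnP i.
  rewrite expr0 -invr1 -(expr0 alpha); apply: zc => //; last by rewrite mem_Tset andbF.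
  exact: prim_order_gt0 pra.
have -> : alpha ^+ i = (alpha ^+ (3 ^ m - 1 - i))^-1.
  apply/esym/mulr1_eq; rewrite -exprD subnK ?(prim_expr_order pra) //.
  exact: ltnW.
apply: zc => //; first by lia.
have /w3_compl : (i < 3 ^ m)%N by lia.
by rewrite mem_Tset; lia.
Qed.

(** * BCH arguments with locators that may coincide *)

Lemma fibre_sum_eq0 (F : finFieldType) (I : finType) (d x : I -> F)
    (S : {set I}) (L : nat) : (#|x @: S| <= L)%N ->
  (forall a, (a < L)%N -> \sum_(i in S) d i * x i ^+ a = 0) ->
  forall k, k \in S -> \sum_(i in S | x i == x k) d i = 0.
Proof.
move=> cardS sum0 k Sk; pose r := enum ((x @: S) :\ x k).
(* [P] vanishes at every value of [x] on [S] except [x k] and has size at most [L], so the vanishing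
   power sums leave only the fibre of [x k]. *)
pose P := \prod_(z <- r) ('X - z%:P).
have szP : (size P <= L)%N.
  rewrite size_prod_XsubC -cardE; apply: leq_trans cardS.
  by rewrite (cardsD1 (x k) (x @: S)) imset_f.
have Pxk : P.[x k] != 0.
  by rewrite -/(root P (x k)) root_prod_XsubC mem_enum !inE eqxx.
have : \sum_(i in S) d i * P.[x i] = 0.
  under eq_bigr => i _ do rewrite horner_coef mulr_sumr.
  rewrite exchange_big big1 //= => a _.
  under eq_bigr => i _ do rewrite mulrCA.
  by rewrite -mulr_sumr sum0 ?mulr0 // (leq_trans (ltn_ord a)).
rewrite (bigID (fun i => x i == x k)) /= [X in _ + X]big1 ?addr0 => [|i /andP[Si neq]].
  under eq_bigr => i /andP[_ /eqP->] do [].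
  by rewrite -mulr_suml => /eqP; rewrite mulf_eq0 (negPf Pxk) orbF => /eqP.
suff /eqP-> : root P (x i) by rewrite mulr0.
by rewrite root_prod_XsubC mem_enum !inE neq imset_f.
Qed.

Lemma row_neq0P (R : nzRingType) (n : nat) (c : 'rV[R]_n) :
  c != 0 -> exists k, c 0 k != 0.
Proof.
move=> c_neq0; apply/existsP; apply: contraR c_neq0 => /existsPn ck.
by apply/eqP/matrixP => i j; rewrite ord1 mxE; apply/eqP/negPn/ck.
Qed.

Lemma word_poly_AP (F : fieldType) (n : nat) (c : 'rV['F_3]_n) (alpha : F)
    (s v a : nat) : (word_poly F c).[alpha ^+ (s + v * a)] =
  \sum_(i in [set i | c 0 i != 0])
    F3_to F (c 0 i) * (alpha ^+ i) ^+ s * ((alpha ^+ i) ^+ v) ^+ a.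
Proof.
rewrite horner_word_poly [RHS]big_mkcond /=; apply: eq_bigr => i _.
rewrite inE; case: eqP => [->|_] /=; first by rewrite /F3_to /= mul0r.
by rewrite -mulrA -[((alpha ^+ i) ^+ v) ^+ a]exprM -exprD -!exprM mulnC.
Qed.

(* The even exponents give [c i + c j = 0] on every pair of opposite locators, so
   the support is a union of such pairs; the odd exponents then only have to
   separate half as many squared locators. *)
Lemma even_odd_BCH_bound (F : finFieldType) (n : nat) (alpha : F)
    (c : 'rV['F_3]_n) (s1 v1 L1 s2 v2 L2 : nat) :
  3%N \in [pchar F] -> n.-primitive_root alpha -> c != 0 ->
  ~~ odd s1 -> ~~ odd v1 -> odd s2 -> ~~ odd v2 ->
  (forall x : F, x ^+ n = 1 -> x ^+ v1 = 1 -> x ^+ 2 = 1) ->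
  (forall x : F, x ^+ n = 1 -> x ^+ v2 = 1 -> x ^+ 2 = 1) ->
  (forall a, (a < L1)%N -> (word_poly F c).[alpha ^+ (s1 + v1 * a)] = 0) ->
  (forall a, (a < L2)%N -> (word_poly F c).[alpha ^+ (s2 + v2 * a)] = 0) ->
  (minn L1.+1 (2 * L2.+1) <= wt c)%N.
Proof.
move=> char3 pra c_neq0 s1_even v1_even s2_odd v2_even sep1 sep2 zero1 zero2.
have [f fE] := F3_to_rmorphism char3.
rewrite geq_min; case: (ltnP L1 (wt c)) => //= le1.
pose S := [set i | c 0 i != 0]; pose z (i : 'I_n) := alpha ^+ i.
pose sq i := z i ^+ 2.
have z_neq0 i : z i != 0 by rewrite expf_neq0 // (prim_root_neq0 pra).
have zn i : z i ^+ n = 1 by rewrite -exprM mulnC exprM (prim_expr_order pra) expr1n.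
have z_inj : injective z.
  move=> i j /eqP; rewrite (eq_prim_root_expr pra) !modn_small // => /eqP.
  exact: val_inj.
have evenX (x : F) v : ~~ odd v -> x ^+ v = (x ^+ 2) ^+ v./2.
  by move=> v_even; rewrite -exprM mul2n even_halfK.
(* For both progressions, the fibres are those of squaring. *)
have fibreE v : ~~ odd v ->
    (forall x : F, x ^+ n = 1 -> x ^+ v = 1 -> x ^+ 2 = 1) ->
    forall i k, (z i ^+ v == z k ^+ v) = (sq i == sq k).
  move=> v_even sep i k; apply/eqP/eqP => [zv|sqE]; last first.
    by rewrite evenX // [RHS]evenX // -/(sq i) sqE.
  have : (z i / z k) ^+ 2 = 1.
    apply: sep; first by rewrite expr_div_n !zn divr1.
    by rewrite expr_div_n zv divff // expf_neq0.
  by rewrite expr_div_n => /divr1_eq.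
have sum1 k : k \in S -> \sum_(i in S | sq i == sq k) f (c 0 i) = 0.
  move=> Sk; have cardS : (#|(fun i => z i ^+ v1) @: S| <= L1)%N.
    by apply: leq_trans (leq_imset_card _ _) le1.
  have : \sum_(i in S | z i ^+ v1 == z k ^+ v1) f (c 0 i) * z i ^+ s1 = 0.
    apply: (fibre_sum_eq0 (x := fun i => z i ^+ v1) cardS _ Sk) => a lta.
    rewrite -[RHS](zero1 a lta) word_poly_AP.
    by apply: eq_bigr => i _; rewrite fE.
  under eq_bigl => i do rewrite fibreE //.
  (* As [s1] is even, [z i ^+ s1] is constant on the fibre and can be cancelled. *)
  under eq_bigr => i /andP[_ /eqP sqE] do rewrite evenX // -/(sq i) sqE.
  move/eqP; rewrite -mulr_suml mulf_eq0 2!expf_eq0 (negPf (z_neq0 k)) !andbF.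
  by rewrite orbF => /eqP.
have fc_neq0 k : k \in S -> f (c 0 k) != 0 by rewrite fmorph_eq0 inE.
have card_sq : (2 * #|sq @: S| <= wt c)%N.
  have -> : wt c = (\sum_(i in S) 1)%N by rewrite sum1_card.
  rewrite (partition_big_imset sq) /= mulnC -sum_nat_const.
  apply: leq_sum => _ /imsetP[k Sk ->].
  (* A one-element fibre would force its nonzero coefficient to vanish. *)
  rewrite (bigD1 k) ?Sk ?eqxx //= ltnS lt0n; apply: contraNneq (fc_neq0 k Sk) => no.
  have := sum1 k Sk; rewrite (bigD1 k) ?Sk ?eqxx //= big1 ?addr0 => [->//|i Hi].
  by move/eqP: no; rewrite sum_nat_eq0 => /forallP/(_ i); rewrite Hi.
apply: leq_trans card_sq; rewrite leq_mul2l /= ltnNge; apply/negP => le2.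
have [k Sk] : exists k, k \in S.
  by have [k ck] := row_neq0P c_neq0; exists k; rewrite inE.
have sum2 : \sum_(i in S | sq i == sq k) f (c 0 i) * z i ^+ s2 = 0.
  have cardS : (#|(fun i => z i ^+ v2) @: S| <= L2)%N.
    apply: leq_trans le2; have -> : (fun i => z i ^+ v2) @: S =
        (fun y => y ^+ v2./2) @: (sq @: S).
      by rewrite -imset_comp; apply: eq_imset => i /=; rewrite evenX.
    exact: leq_imset_card.
  under eq_bigl => i do rewrite -(fibreE _ v2_even sep2).
  apply: (fibre_sum_eq0 (x := fun i => z i ^+ v2) cardS _ Sk) => a lta.
  rewrite -[RHS](zero2 a lta) word_poly_AP.
  by apply: eq_bigr => i _; rewrite fE.
(* Since [s2] is odd, the weight [z i ^+ s2 + z k ^+ s2] vanishes at the opposite locator and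
   doubles at [k], where characteristic 3 keeps it nonzero. *)
have : \sum_(i in S | sq i == sq k) f (c 0 i) * (z i ^+ s2 + z k ^+ s2) = 0.
  under eq_bigr => i _ do rewrite mulrDr.
  by rewrite big_split /= sum2 -mulr_suml sum1 // mul0r addr0.
rewrite (bigD1 k) ?Sk ?eqxx //= big1 ?addr0 => [/eqP|i /andP[/andP[_]]].
  rewrite mulf_eq0 (negPf (fc_neq0 k Sk)) -mulr2n -mulr_natr mulf_eq0.
  by rewrite expf_eq0 (negPf (z_neq0 k)) andbF -(dvdn_pcharf char3).
rewrite eqf_sqr => /orP[/eqP/z_inj->|/eqP->]; first by rewrite eqxx.
by rewrite exprNn -signr_odd s2_odd expr1 mulN1r addNr mulr0.
Qed.

(** * Exponents having gcd 2 with [n] *)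

Lemma expr2_eq1_of_pow3 (F : fieldType) (h : nat) (x : F) :
  x ^+ (3 ^ (2 * h).+1 - 1) = 1 -> x ^+ (3 ^ (2 * h)) = x -> x ^+ 2 = 1.
Proof.
move=> xn xh; have x_neq0 : x != 0.
  apply: contra_eq_neq xn => ->; rewrite expr0n gtn_eqF 1?eq_sym ?oner_eq0 //.
  by rewrite subn_gt0 -{1}(expn0 3) ltn_exp2l.
have x3 : x ^+ 3 = x.
  rewrite -[in LHS]xh -exprM mulnC -expnS -[RHS]mulr1 -xn -exprS; congr (_ ^+ _).
  by have := expn_gt0 3 (2 * h).+1; lia.
by apply: (mulfI x_neq0); rewrite -exprS mulr1.
Qed.

Lemma expr2_eq1_subn (F : fieldType) (h : nat) (x : F) :
  x ^+ (3 ^ (2 * h).+1 - 1) = 1 -> x ^+ (3 ^ h - 1) = 1 -> x ^+ 2 = 1.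
Proof.
move=> xn xh; apply: (expr2_eq1_of_pow3 xn).
have xE : x ^+ (3 ^ h) = x.
  by rewrite -[RHS]mulr1 -xh -exprS; congr (_ ^+ _); have := expn_gt0 3 h; lia.
by rewrite mul2n -addnn expnD exprM !xE.
Qed.

(** The power [3 ^ h] inverts [y], so applying it twice fixes [y] and gives [y ^+ 2 = 1]. Thus
    [x ^+ 4 = 1], and [n] is 2 modulo 4. *)
Lemma expr2_eq1_addn (F : fieldType) (h : nat) (x : F) :
  x ^+ (3 ^ (2 * h).+1 - 1) = 1 -> x ^+ (2 * (3 ^ h + 1)) = 1 -> x ^+ 2 = 1.
Proof.
move=> xn; rewrite exprM; set y := x ^+ 2 => yh.
have yn : y ^+ (3 ^ (2 * h).+1 - 1) = 1 by rewrite -exprM mulnC exprM xn expr1n.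
have yE : y ^+ (3 ^ h) = y^-1.
  by apply/esym/mulr1_eq; rewrite -exprS -addn1.
have y2 : y ^+ 2 = 1.
  apply: (expr2_eq1_of_pow3 yn).
  by rewrite mul2n -addnn expnD exprM yE exprVn yE invrK.
have [q nE] : exists q, (3 ^ (2 * h).+1 - 1 = 4 * q + 2)%N.
  exists ((3 ^ (2 * h).+1 - 1) %/ 4)%N; rewrite expnS expnM.
  suff : (3 ^ 2) ^ h = 1 %[mod 4] by lia.
  by rewrite -modnXm exp1n.
by move: xn; rewrite nE exprD [x ^+ (4 * q)]exprM (exprM x 2 2) -/y y2 expr1n mul1r.
Qed.

(** * Weight bounds for the dual code *)

Lemma dual_code01_wt (F : finFieldType) (alpha : F) (h : nat)
    (c : 'rV['F_3]_(3 ^ (2 * h).+1 - 1)) :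
  (0 < h)%N -> 3%N \in [pchar F] -> (3 ^ (2 * h).+1 - 1).-primitive_root alpha ->
  c \in dual_code (cyclic_code alpha 0 1 (2 * h).+1) -> c != 0 ->
  (3 ^ h < wt c)%N.
Proof.
move=> h_gt0 char3 pra Cdc c_neq0.
have p_gt1 : (1 < 3 ^ h)%N by rewrite -(expn0 3) ltn_exp2l.
have p_odd : odd (3 ^ h) by rewrite oddX orbT.
have p2 : (3 ^ (2 * h).+1 = 3 * (3 ^ h * 3 ^ h))%N by rewrite expnS mul2n -addnn expnD.
have w3E x y d : (x < 3 ^ h)%N -> (y < 3 ^ h)%N -> (d < 3)%N ->
    w3 (2 * h).+1 (x + 3 ^ h * (y + 3 ^ h * d)) = (w3 h x + (w3 h y + d))%N.
  move=> ltx lty ltd.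
  have -> : (2 * h).+1 = (h + (h + 1))%N by lia.
  by rewrite !w3_cat // w3_1.
have zc := dual_code01_zeros char3 _ pra Cdc.
(* This even top digit makes the constant digit sum [2 * h + d] a multiple of 4. *)
pose d := (2 * odd h)%N.
have := @even_odd_BCH_bound F _ alpha c (3 ^ h - 1 + d * 3 ^ (2 * h)) (3 ^ h - 1)
  (3 ^ h) (3 ^ (2 * h) + 3 ^ h + 1) (2 * (3 ^ h + 1)) (3 ^ h - 1)./2 char3 pra c_neq0.
have pp : (3 ^ (2 * h) = 3 ^ h * 3 ^ h)%N by rewrite mul2n -addnn expnD.
set p := (3 ^ h)%N in p_gt1 p_odd p2 w3E pp *.
have p_gt0 := ltnW p_gt1.
have -> : (minn p.+1 (2 * ((p - 1)./2).+1) = p.+1)%N by lia.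
apply; rewrite ?oddD ?oddM ?oddB // ?p_odd ?oddX ?orbT //.
- exact: expr2_eq1_subn.
- exact: expr2_eq1_addn.
- move=> a lta; apply: zc; first by rewrite /= oddM.
    have : ((p - 1) * a.+1 <= (p - 1) * p)%N by rewrite leq_mul.
    by rewrite p2 pp /d; case: (odd h); nia.
  (* The two lower blocks of [h] digits are complementary. *)
  have -> : (p - 1 + d * 3 ^ (2 * h) + (p - 1) * a =
      (p - 1 - a) + p * (a + p * d))%N by rewrite pp; nia.
  rewrite w3E //; [|lia|by rewrite /d; case: odd].
  by have := w3_compl lta; rewrite -/p /d; lia.
- move=> a lta; apply: zc; first by rewrite /= oddM.
    by rewrite p2 pp; nia.
  (* The odd number [b = (2 * a).+1] fills both blocks below a top digit 1: the sum [2 * w3 h b + 1]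
     is 3 modulo 4 because [w3 h b] is odd. *)
  have -> : (3 ^ (2 * h) + p + 1 + 2 * (p + 1) * a =
      (2 * a).+1 + p * ((2 * a).+1 + p * 1))%N by rewrite pp; nia.
  have ltb : ((2 * a).+1 < p)%N by lia.
  by rewrite w3E //; have := odd_w3 ltb; lia.
Qed.

(** Here [v]-th powers separate the locators, so each fibre is a single position. *)
Lemma BCH_bound (F : finFieldType) (n : nat) (alpha : F)
    (c : 'rV['F_3]_n) (s v L : nat) :
  3%N \in [pchar F] -> n.-primitive_root alpha -> c != 0 ->
  (forall x : F, x ^+ n = 1 -> x ^+ v = 1 -> x = 1) ->
  (forall a, (a < L)%N -> (word_poly F c).[alpha ^+ (s + v * a)] = 0) ->
  (L < wt c)%N.
Proof.
move=> char3 pra c_neq0 sep zero; have [f fE] := F3_to_rmorphism char3.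
rewrite ltnNge; apply/negP => leL.
have a_neq0 i : alpha ^+ i != 0 by rewrite expf_neq0 // (prim_root_neq0 pra).
have [k ck] := row_neq0P c_neq0.
have Sk : k \in [set i | c 0 i != 0] by rewrite inE.
have := @fibre_sum_eq0 F _ (fun i => F3_to F (c 0 i) * (alpha ^+ i) ^+ s)
  (fun i : 'I_n => (alpha ^+ i) ^+ v) _ _ (leq_trans (leq_imset_card _ _) leL).
move=> /(_ _ k Sk) sum0; have {sum0}/eqP := sum0 (fun a lta =>
  etrans (esym (word_poly_AP c alpha s v a)) (zero a lta)).
rewrite (bigD1 k) ?Sk ?eqxx //= big1 => [|i /andP[/andP[_ /eqP xE] /eqP neq]].
  by rewrite addr0 mulf_eq0 expf_eq0 (negPf (a_neq0 k)) andbF -fE fmorph_eq0 orbF (negPf ck).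
case: neq; apply/val_inj/eqP => /=.
have /divr1_eq/eqP : alpha ^+ i / alpha ^+ k = 1.
  apply: sep; last by rewrite expr_div_n xE divff // expf_neq0.
  by rewrite expr_div_n -!exprM ![(_ * n)%N]mulnC !exprM (prim_expr_order pra) !expr1n divr1.
by rewrite (eq_prim_root_expr pra) !modn_small.
Qed.

(* For [m = 3] the exponents 11, 16, 21, 26 = 0, 31 = 5 modulo 26 are all zeros. *)
Lemma dual_code01_wt_m3 (F : finFieldType) (alpha : F) (c : 'rV['F_3]_(3 ^ 3 - 1)) :
  3%N \in [pchar F] -> (3 ^ 3 - 1).-primitive_root alpha ->
  c \in dual_code (cyclic_code alpha 0 1 3) -> c != 0 -> (5 < wt c)%N.
Proof.
move=> char3 pra Cdc c_neq0.
have zc i := @dual_code01_zeros F alpha 3 c i char3 isT pra Cdc.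
have w3_val i : w3 3 i = (i %% 3 + (i %/ 3 %% 3 + i %/ 3 %/ 3 %% 3))%N.
  by rewrite !w3_rec /w3 big_ord0 addn0.
apply: (@BCH_bound _ _ _ _ 11 5 _ char3 pra c_neq0) => [x x26 x5|a lta].
  by rewrite -x26 (exprD x 25 1) (exprM x 5 5) x5 expr1n mul1r.
rewrite -(expr_mod _ (prim_expr_order pra)); apply: zc.
  by rewrite ltn_mod.
by rewrite w3_val; move: a lta; do 5!case=> //.
Qed.

Theorem theorem9 (m : nat) (F : finFieldType) (alpha : F) :
  (3 <= m)%N -> odd m -> #|F| = (3 ^ m)%N ->
  (3 ^ m - 1).-primitive_root alpha ->
  let Cd := dual_code (cyclic_code alpha 0 1 m) in
  ((m %% 4 = 3)%N ->
     (2 * \dim (code_space Cd) = 3 ^ m - 1 - 2)%N /\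
     (forall c, c \in Cd -> c != 0 -> (3 ^ ((m - 1) %/ 2) + 9 <= 2 * wt c)%N)) /\
  ((m %% 4 = 1)%N ->
     (2 * \dim (code_space Cd) = 3 ^ m - 1)%N /\
     (forall c, c \in Cd -> c != 0 -> (3 ^ ((m - 1) %/ 2) + 7 <= 2 * wt c)%N)).
Proof.
move=> m_ge3 m_odd cardF pra Cd.
have char3 : 3%N \in [pchar F] := card_finPcharP cardF isT.
have m_gt0 := odd_gt0 m_odd.
have [dimCd _] := dual_cyclic_code_dim_zeros 0 1 char3 m_gt0 pra.
have sizeT := size_Tset01 m_gt0 m_odd.
(* The stronger bound holds for both residues of [m]: [3 ^ h + 9 <= 2 * (3 ^ h + 1)] once [h >= 2],
   and weight 6 gives equality of the two sides at [m = 3]. *)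
have wtCd c : c \in Cd -> c != 0 -> (3 ^ ((m - 1) %/ 2) + 9 <= 2 * wt c)%N.
  have [h mE] : exists h, m = (2 * h).+1 by exists m./2; lia.
  rewrite {}/Cd; move: {dimCd sizeT cardF m_odd m_gt0} m_ge3 c pra; rewrite {m}mE.
  have -> : (((2 * h).+1 - 1) %/ 2 = h)%N by lia.
  case: h => [|[|h]] // _ c pra Cdc c_neq0.
    exact: (@leq_mul 2 6 2 _ isT (dual_code01_wt_m3 char3 pra Cdc c_neq0)).
  have := dual_code01_wt (isT : (0 < h.+2)%N) char3 pra Cdc c_neq0.
  have : (3 ^ 2 <= 3 ^ h.+2)%N by rewrite leq_exp2l.
  by lia.
rewrite dimCd; split=> mod4; split.
- by rewrite mod4 eqxx in sizeT; lia.
- exact: wtCd.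
- by rewrite mod4 /= in sizeT; lia.
- by move=> c Cdc c_neq0; apply: leq_trans (wtCd c Cdc c_neq0); rewrite leq_add2l.
Qed.
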